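(* Let $X$ be a topological space with a strong rank $2$-diagonal. Then $$|X|\le wL(X)^{\pi\chi(X)}.$$
   Context: The weak Lindelöf number $wL(X)$ is the least cardinal $\kappa$ such that every open cover of $X$ has a subfamily of cardinality at most $\kappa$ whose union is dense in $X$. For a family $\mathcal{U}$ of subsets of $X$ and $A\subseteq X$, put $\mathrm{St}(A,\mathcal{U})=\bigcup\{U\in\mathcal{U}:A\cap U\ne\emptyset\}$, $\mathrm{St}(x,\mathcal{U})=\mathrm{St}(\{x\},\mathcal{U})$ and $\mathrm{St}^2(x,\mathcal{U})=\mathrm{St}(\mathrm{St}(x,\mathcal{U}),\mathcal{U})$. $X$ has a strong rank $2$-diagonal if there is a sequence $\{\mathcal{U}_n:n<\omega\}$ of open covers of $X$ such that for all $x\ne y$ in $X$ there is $n<\omega$ with $y\notin\overline{\mathrm{St}^2(x,\mathcal{U}_n)}$. A local $\pi$-base at $x\in X$ is a family $\mathcal{V}$ of non-empty open subsets of $X$ such that every open neighbourhood of $x$ contains a member of $\mathcal{V}$; the $\pi$-character $\pi\chi(X)$ is the supremum over $x\in X$ of the least cardinality of a local $\pi$-base at $x$. *)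

(* Defs.v *)
From mathcomp Require Import all_boot all_classical topology.

Set Implicit Arguments.
Unset Strict Implicit.
Unset Printing Implicit Defensive.

Local Open Scope classical_set_scope.
Local Open Scope card_scope.

(** A cardinal is represented by any type of that cardinality: cardinals are
    compared with [#<=] on full sets, and [L -> K] represents K ^ L.
    No cardinal function below is rounded up to an infinite value. *)

Definition is_least_cardinal (P : Type -> Prop) (K : Type) : Prop :=
  P K /\ forall K' : Type, P K' -> [set: K] #<= [set: K'].

(** A representative of the least cardinal satisfying [P]. The default value
    [void] is never used below: see [weak_lindelof_numberP], [pi_character_atP]
    and [pi_characterP]. *)
Definition least_cardinal (P : Type -> Prop) : Type :=
  if pselect (exists K, is_least_cardinal P K) is left e then projT1 (cid e)
  else void.

(** Cardinals are well-ordered. Zorn's lemma gives a maximal subset [S] of the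
    product on which every projection is injective; some projection must map
    [S] onto its factor, and that factor is the least one. *)
Lemma ex_least_card (I : Type) (K : I -> Type) (i0 : I) :
  exists i, forall j, [set: K i] #<= [set: K j].
Proof.
pose P (S : set (forall i, K i)) :=
  forall f g i, S f -> S g -> f i = g i -> f = g.
have [F FP Ftot|S [SP Smax]] := @Zorn_bigcup _ P.
  move=> f g i [A FA Af] [B FB Bg].
  by have [AB|BA] := Ftot _ _ FA FB;
    [exact: FP FB _ _ i (AB _ Af) Bg|exact: FP FA _ _ i Af (BA _ Bg)].
have [[i iS]|nsurj] :=
    pselect (exists i, forall k : K i, exists2 f, S f & f i = k).
  exists i => j; pose h k := projT1 (cid2 (iS k)).
  have hP k : S (h k) /\ h k i = k by rewrite /h; case: cid2.
  apply: (@card_le_trans _ _ _ [set h k j | k in [set: K i]]); last first.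
    exact: card_leT.
  have hinj : {in [set: K i] &, injective (h^~ j)}.
    move=> k l _ _ hkl; have [Sk ek] := hP k; have [Sl el] := hP l.
    by rewrite -ek -el (SP _ _ _ Sk Sl hkl).
  by have := inj_card_eq hinj; rewrite card_eq_le => /andP[].
have new i : exists k : K i, forall f, S f -> f i <> k.
  apply: contrapT => nk; apply: nsurj; exists i => k.
  apply: contrapT => nf; apply: nk; exists k => f Sf fk.
  by apply: nf; exists f.
pose g i := projT1 (cid (new i)).
have gP i f : S f -> f i <> g i by exact: (projT2 (cid (new i))).
exfalso; apply: (Smax (S `|` [set g])).
  by split=> [f Sf|/(_ g (or_intror erefl)) Sg]; [left|exact: (gP i0 g Sg)].
move=> f f' i [Sf|->] [Sf'|->] // e.
- exact: SP e.
- by case: (gP i f Sf).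
- by case: (gP i f' Sf').
Qed.

Lemma card_le_total (K L : Type) :
  [set: K] #<= [set: L] \/ [set: L] #<= [set: K].
Proof.
have [[] H] := @ex_least_card bool (fun b => if b then K else L) true.
- by left; exact: (H false).
- by right; exact: (H true).
Qed.

Lemma least_cardinalP (P : Type -> Prop) :
  (forall K L : Type, [set: K] #= [set: L] -> P K -> P L) ->
  (exists K, P K) -> is_least_cardinal P (least_cardinal P).
Proof.
move=> Peq [K0 PK0].
suff H : exists K, is_least_cardinal P K.
  by rewrite /least_cardinal; case: pselect => // e; case: cid.
pose I := {B : set K0 | P (set_type B)}.
have PT : P (set_type [set: K0]).
  by apply: Peq PK0; exact: card_setT_sym.
have [[B PB] Bmin] :=
  @ex_least_card I (fun B => set_type (sval B)) (exist _ _ PT).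
exists (set_type B); split=> // K' PK'.
have [K'K0|K0K'] := card_le_total K' K0; last first.
  by apply: card_le_trans K0K'; rewrite (card_le_eql (card_setT B)) card_leT.
have [B' K'B'] : exists B' : set K0, [set: K'] #= B'.
  have [f] := card_leP K'K0.
  pose h (k : K') : K0 := val (f (to_setT k)).
  exists [set h k | k in [set: K']].
  rewrite card_eq_sym; apply: inj_card_eq => k l _ _ /val_inj e.
  by have /(congr1 val) := 'inj_f (in_setT _) (in_setT _) e.
have PB' : P (set_type B').
  by apply: Peq PK'; rewrite (card_eql K'B'); exact: card_setT_sym.
apply: card_le_trans (Bmin (exist _ _ PB')) _ => /=.
by rewrite (card_le_eql (card_setT B')) (card_le_eqr K'B') card_lexx.
Qed.

Definition open_cover (X : topologicalType) (U : set (set X)) : Prop :=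
  (forall A, U A -> open A) /\ \bigcup_(A in U) A = [set: X].

Definition weakly_lindelof_le (X : topologicalType) (K : Type) : Prop :=
  forall U : set (set X), open_cover U ->
    exists V : set (set X),
      [/\ V `<=` U, V #<= [set: K] & dense (\bigcup_(A in V) A)].

Definition weak_lindelof_number (X : topologicalType) : Type :=
  least_cardinal (weakly_lindelof_le X).

Lemma weak_lindelof_numberP (X : topologicalType) :
  is_least_cardinal (weakly_lindelof_le X) (weak_lindelof_number X).
Proof.
apply: least_cardinalP => [K L KL HK U /HK[V [VU VK dV]]|].
  by exists V; split; rewrite // -(card_le_eqr KL).
exists (set X) => U [Uo Uc]; exists U; split=> //; first exact: card_leT.
by move=> O [x Ox] _; rewrite Uc setIT; exists x.
Qed.

Definition local_pi_base (X : topologicalType) (x : X) (V : set (set X)) :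
    Prop :=
  (forall A, V A -> open A /\ A !=set0) /\
  (forall O, open_nbhs x O -> exists2 A, V A & A `<=` O).

Definition pi_character_at (X : topologicalType) (x : X) : Type :=
  least_cardinal (fun K => exists2 V, local_pi_base x V & V #= [set: K]).

(** The supremum of a family of cardinals is its least upper bound. *)
Definition pi_character (X : topologicalType) : Type :=
  least_cardinal
    (fun K => forall x : X, [set: pi_character_at x] #<= [set: K]).

Lemma pi_character_atP (X : topologicalType) (x : X) :
  is_least_cardinal (fun K => exists2 V, local_pi_base x V & V #= [set: K])
    (pi_character_at x).
Proof.
apply: least_cardinalP => [K L KL [V Vx VK]|].
  by exists V; rewrite // -(card_eqr KL).
pose V := [set A : set X | open A /\ A !=set0].
exists (set_type V), V; last exact: card_setT_sym.
split=> [A //|O [Oo Ox]]; exists O => //.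
by split=> //; exists x.
Qed.

Lemma pi_characterP (X : topologicalType) :
  is_least_cardinal
    (fun K => forall x : X, [set: pi_character_at x] #<= [set: K])
    (pi_character X).
Proof.
apply: least_cardinalP => [K L KL HK x|].
  by rewrite -(card_le_eqr KL).
exists (set X) => x; have [[V _ VK] _] := pi_character_atP x.
by rewrite -(card_le_eql VK) card_leT.
Qed.

Definition star (X : Type) (A : set X) (U : set (set X)) : set X :=
  \bigcup_(B in [set B | U B /\ A `&` B !=set0]) B.

Definition star2 (X : Type) (x : X) (U : set (set X)) : set X :=
  star (star [set x] U) U.

Definition strong_rank2_diagonal (X : topologicalType) : Prop :=
  exists U : nat -> set (set X),
    (forall n, open_cover (U n)) /\
    (forall x y, x <> y -> exists n, ~ closure (star2 x (U n)) y).

(* Main.v *)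
Require Import Defs.
From mathcomp Require Import all_boot all_classical topology.

Local Open Scope classical_set_scope.
Local Open Scope card_scope.

(** Let [U n] witness the strong rank 2-diagonal, and let [V n] be a subfamily
    of [U n], of size at most wL, with dense union. Given [x] and [n], pick [O]
    in [U n] containing [x]; every member [B] of a local pi-base at [x] that
    lies inside [O] meets some member of [V n], which is then contained in
    St^2(x, U n). The members of [V n] picked in this way have a union [W x n]
    contained in St^2(x, U n) and having [x] in its closure. If [W x n = W y n]
    for all [n], then [y] is in the closure of every St^2(x, U n), so [x = y].
    This gives |X| <= wL^(omega * pi-character), and omega is absorbed by an
    infinite pi-character. If the pi-character is finite then [X] is discrete,
    so |X| = wL. *)

Lemma card_le_inj (T U : Type) (f : T -> U) :
  injective f -> [set: T] #<= [set: U].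
Proof.
move=> finj; have fi : {in [set: T] &, injective f} by move=> x y _ _ /finj.
by rewrite -(card_le_eql (inj_card_eq fi)) card_leT.
Qed.

Lemma card_le_ex_inj (T U : Type) (A : set T) :
  A #<= [set: U] -> exists f : A -> U, injective f.
Proof.
rewrite -(card_le_eql (card_setT A)) => /card_leP[f].
exists (fun a => val (f (to_setT a))) => a b /val_inj e.
by have /(congr1 val) := 'inj_f (in_setT _) (in_setT _) e.
Qed.

Lemma card_le_ex_surj (T U : Type) (A : set T) :
  A !=set0 -> A #<= [set: U] ->
  exists g : U -> T, (forall u, A (g u)) /\ forall a, A a -> exists u, g u = a.
Proof.
move=> [a0 Aa0] /card_le_ex_inj[f finj].
(* A left inverse of [f], with the default value [a0] off the range of [f]. *)
have H u : exists a, A a /\ forall b : A, f b = u -> a = val b.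
  have [[b bu]|nb] := pselect (exists b, f b = u).
    exists (val b); split=> [|c cu]; first exact: set_valP.
    by congr val; apply: finj; rewrite bu.
  by exists a0; split=> // b bu; case: nb; exists b.
have [g gP] := choice H.
exists g; split=> [u|a Aa]; first by case: (gP u).
exists (f (exist _ a (mem_set Aa))).
by have [_ /(_ _ erefl) ->] := gP (f (exist _ a (mem_set Aa))).
Qed.

(** By Zorn's lemma, a maximal family [F] of injective sequences in [K] with
    pairwise disjoint ranges covers [K] up to a finite set, which is absorbed
    into the range of one member [f0]; hence [K] is equipotent to
    [F * nat]. *)
Lemma infinite_card_natM (K : Type) :
  infinite_set [set: K] -> [set: nat * K] #<= [set: K].
Proof.
move=> Kinf.
pose P (F : set (nat -> K)) := forall f g m n, F f -> F g ->
  f m = g n -> f = g /\ m = n.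
have [G GP Gtot|F [FP Fmax]] := @Zorn_bigcup _ P.
  move=> f g m n [A GA Af] [B GB Bg].
  by have [AB|BA] := Gtot _ _ GA GB;
    [exact: (GP _ GB) (AB _ Af) Bg|exact: (GP _ GA) Af (BA _ Bg)].
pose R := [set k | forall f n, F f -> f n <> k].
have Rfin : finite_set R.
  apply: contrapT => /infiniteP.
  rewrite -(card_le_eqr (card_setT R)) => /card_leP[s0].
  pose s n : K := val (val (s0 (to_setT n))).
  have sR n : R (s n) by exact: set_valP.
  have sinj : injective s.
    move=> m n /val_inj/val_inj e.
    by have /(congr1 val) := 'inj_s0 (in_setT _) (in_setT _) e.
  apply: (Fmax (F `|` [set s])).
    split=> [f Ff|/(_ s (or_intror erefl)) Fs]; first by left.
    exact: (sR 0 s 0 Fs).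
  move=> f g m n [Ff|->] [Fg|->] e.
  - exact: FP e.
  - by case: (sR n f m Ff).
  - by case: (sR m g n Fg).
  - by split=> //; exact: sinj.
have [f0 Ff0] : F !=set0.
  apply: contrapT => /nonemptyPn F0; apply: Kinf.
  by apply: sub_finite_set Rfin => k _ f n; rewrite F0.
have [s [_ ssurj]] : exists g : nat -> K,
    (forall u, (range f0 `|` R) (g u)) /\
    forall a, (range f0 `|` R) a -> exists u, g u = a.
  apply: card_le_ex_surj; first by exists (f0 0); left; exists 0.
  change (countable (range f0 `|` R)); rewrite -bigcup2E.
  apply: bigcup_countable => // i _; case: i => [|[|i]] //=.
  - exact/card_image_le.
  - exact: finite_set_countable.
(* A pair [(f0, n)] codes [s n], where [s] enumerates the range of [f0] together with [R]; any other
   pair [(f, n)] codes [f n]. *)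
have H k : exists p : (nat -> K) * nat,
    F p.1 /\ (if pselect (p.1 = f0) then s p.2 else p.1 p.2) = k.
  have [Sk|nSk] := pselect ((range f0 `|` R) k).
    have [n <-] := ssurj k Sk; exists (f0, n); split=> //=.
    by case: pselect.
  have [f [n [Ff fk]]] : exists f n, F f /\ f n = k.
    apply: contrapT => nf; apply: nSk; right => f n Ff fk.
    by apply: nf; exists f, n.
  exists (f, n); split=> //=; case: pselect => // ff0.
  by case: nSk; left; exists n; rewrite // -ff0.
have [c cP] := choice H.
(* If [(f, n)] codes [k], then [(m, k)] goes to the term of [f] whose index encodes [(m, n)]; by
   [FP] this term determines [f], [m] and [n]. *)
apply: (@card_le_inj _ _
  (fun mk => (c mk.2).1 (choice.pickle (mk.1, (c mk.2).2)))).
move=> [m k] [n l] /= e.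
have [e1 /(pcan_inj choice.pickleK)[-> e2]] := FP _ _ _ _ (cP k).1 (cP l).1 e.
by rewrite -(cP k).2 -(cP l).2 e1 e2.
Qed.

Section StrongRank2Diagonal.
Variable X : topologicalType.

Lemma local_pi_base_nonempty (x : X) (V : set (set X)) :
  local_pi_base x V -> V !=set0.
Proof.
move=> [_ /(_ [set: X])[|A VA _]]; first by split=> //; exact: openT.
by exists A.
Qed.

Lemma open_cover_star2 (U : set (set X)) (x : X) : open_cover U ->
  open_nbhs x (star2 x U).
Proof.
move=> [Uo Uc]; split; first by apply: bigcup_open => A [/Uo].
have [A UA Ax] : (\bigcup_(A in U) A) x by rewrite Uc.
exists A => //; split=> //; exists x; split=> //.
by exists A => //; split=> //; exists x.
Qed.

Lemma strong_rank2_accessible : strong_rank2_diagonal X -> accessible_space X.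
Proof.
move=> [U [Uc Usep]] x y /eqP xy.
have [n ny] := Usep x y xy.
exists (star2 x (U n)); have [o xS] := open_cover_star2 _ x (Uc n).
split=> //; first by rewrite inE.
by rewrite inE => /subset_closure.
Qed.

(** The choice at [x] is kept as functions [g x n : K -> V n] instead of their unions W x n. Coding
    each [V n] in [L] turns it into one map on [nat * K], which determines [x]. *)
Lemma strong_rank2_card_le (K L : Type) :
  strong_rank2_diagonal X -> weakly_lindelof_le X L ->
  (forall x : X, exists2 V, local_pi_base x V & V #<= [set: K]) ->
  [set: X] #<= [set: nat * K -> L].
Proof.
move=> [U [Uc Usep]] wL pb.
have [V VP] := choice (fun n => wL (U n) (Uc n)).
have H x n : exists g : K -> V n,
    (forall k, val (g k) `<=` star2 x (U n)) /\
    (forall O, open_nbhs x O -> exists k, val (g k) `&` O !=set0).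
  have [_ _ Vd] := VP n; have [Uo Ucov] := Uc n.
  have [O UO Ox] : (\bigcup_(A in U n) A) x by rewrite Ucov.
  have [B [Bo Bsub] BK] := pb x.
  (* [b] lists, with repetitions, the members of the pi-base inside [O]. *)
  have [b [bW bsurj]] : exists b : K -> set X,
      (forall k, (B `&` [set C | C `<=` O]) (b k)) /\
      forall C, (B `&` [set C | C `<=` O]) C -> exists k, b k = C.
    apply: card_le_ex_surj; last exact: card_le_trans (subset_card_le _) BK.
    by have [C BC CO] := Bsub O (conj (Uo _ UO) Ox); exists C.
  have ex k : exists A : V n, val A `&` b k !=set0.
    have [/Bo[bo b0] _] := bW k.
    have [z [bz [A VA Az]]] := Vd (b k) b0 bo.
    by exists (exist _ A (mem_set VA)), z.
  have [g gP] := choice ex.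
  exists g; split=> [k z gz|O' [O'o O'x]].
    have [w [gw bw]] := gP k.
    exists (val (g k)) => //; split.
      by have [VU _ _] := VP n; apply: VU; exact: set_valP.
    exists w; split=> //; exists O; last exact: (bW k).2.
    by split=> //; exists x.
  (* Shrinking [O'] to its trace on [O] yields a member of the pi-base that occurs in the list
     [b]. *)
  have [C BC CO] := Bsub (O `&` O') (conj (openI (Uo _ UO) O'o) (conj Ox O'x)).
  have [k kC] : exists k, b k = C.
    by apply: bsurj; split=> // z /CO[].
  exists k; have [w [gw bw]] := gP k.
  by exists w; split=> //; apply: (CO _ _).2; rewrite -kC.
pose g x n := projT1 (cid (H x n)).
have gsub x n k : val (g x n k) `<=` star2 x (U n).
  exact: (projT2 (cid (H x n))).1.
have gmeet x n O : open_nbhs x O -> exists k, val (g x n k) `&` O !=set0.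
  exact: (projT2 (cid (H x n))).2.
have E n : exists e : V n -> L, injective e.
  by have [_ Vcard _] := VP n; exact: card_le_ex_inj.
pose e n := projT1 (cid (E n)).
have einj n : injective (e n) by exact: (projT2 (cid (E n))).
apply: (@card_le_inj _ _ (fun x nk => e nk.1 (g x nk.1 nk.2))) => x y exy.
(* Equal codes give [g y n = g x n]: these sets lie in St^2(x, U n) and meet every neighbourhood of
   [y]. *)
apply: contrapT => xy; have [n] := Usep x y xy; apply => O.
rewrite nbhsE => -[O' O'y O'O].
have [k [z [gz O'z]]] := gmeet y n O' O'y.
exists z; split; last exact: O'O.
apply: (gsub x n k).
by rewrite (einj n _ _ (congr1 (fun h => h (n, k)) exy : e n _ = e n _)).
Qed.

(** Otherwise each member of [V] has a point other than [x]. Removing these finitely many points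
    leaves an open neighbourhood of [x] that contains no member of [V]. *)
Lemma accessible_finite_pi_base_open (x : X) (V : set (set X)) :
  accessible_space X -> local_pi_base x V -> finite_set V -> open [set x].
Proof.
move=> acc [Vo Vsub] Vfin; apply: contrapT => nox.
have H (A : set X) : exists y, V A -> A y /\ y <> x.
  have [VA|] := pselect (V A); last by exists x.
  apply: contrapT => nA; apply: nox.
  suff -> : [set x] = A by exact: (Vo A VA).1.
  have Ax y : A y -> y = x.
    by move=> Ay; apply: contrapT => yx; apply: nA; exists y.
  have [_ [a Aa]] := Vo A VA.
  by rewrite eqEsubset; split=> [y ->|y /Ax //]; rewrite -(Ax a Aa).
have [c cP] := choice H.
have cfin : finite_set (c @` V) by exact: finite_image.
have ccl := (accessible_finite_set_closed.1 acc) _ cfin.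
have [|A VA Asub] := Vsub (~` (c @` V)).
  split; first exact: closed_openC.
  by move=> [A VA Ax]; have [_] := cP A VA; apply.
by have [Ac _] := cP A VA; apply: (Asub _ Ac); exists A.
Qed.

(** In the cover by singletons, a subfamily with dense union must contain every singleton. *)
Lemma discrete_card_le (L : Type) :
  (forall x : X, open [set x]) -> weakly_lindelof_le X L ->
  [set: X] #<= [set: L].
Proof.
move=> Xo wL.
have [|V [VU VL Vd]] := wL (range set1).
  split=> [A [x _ <-] //|].
  by rewrite eqEsubset; split=> // x _; exists [set x] => //; exists x.
have V1 x : V [set x].
  have [|y [-> [A VA]]] := Vd [set x] _ (Xo x); first by exists x.
  by have [z _ zA] := VU A VA; rewrite -zA in VA * => ->.
have [f finj] := card_le_ex_inj _ _ _ VL.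
apply: (@card_le_inj _ _ (fun x => f (exist _ [set x] (mem_set (V1 x))))).
by move=> x y /finj/(congr1 val)/= xy; have : [set y] x by rewrite -xy.
Qed.

Lemma pi_character_base (x : X) :
  exists2 V, local_pi_base x V & V #<= [set: pi_character X].
Proof.
have [[V Vx VK] _] := pi_character_atP x; exists V => //.
by rewrite (card_le_eql VK); exact: (pi_characterP X).1.
Qed.

End StrongRank2Diagonal.

Theorem proposition4p9 (X : topologicalType) (hX : strong_rank2_diagonal X) :
  [set: X] #<= [set: pi_character X -> weak_lindelof_number X].
Proof.
have [wL _] := weak_lindelof_numberP X.
have [Kfin|Kinf] := pselect (finite_set [set: pi_character X]).
  have XL : [set: X] #<= [set: weak_lindelof_number X].
    apply: discrete_card_le _ _ _ wL => x; have [V Vx VK] := pi_character_base X x.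
    apply: accessible_finite_pi_base_open _ _ _ _ Vx _.
      exact: strong_rank2_accessible.
    exact: card_le_finite VK Kfin.
  (* Constant functions embed L into L^K only for inhabited K; a point of [X] provides an element
     [k] of K, through a member of a pi-base at that point. *)
  have [->|/set0P[x _]] := eqVneq [set: X] set0; first exact: card_ge0.
  have [V Vx VK] := pi_character_base X x.
  have [A VA] := local_pi_base_nonempty _ _ _ Vx.
  have [_ [_ /(_ A VA)[k _]]] := card_le_ex_surj _ _ _ (ex_intro _ A VA) VK.
  apply: card_le_trans XL (card_le_inj _ _ (fun l=> fun=> l) _) => l l'.
  by move/(congr1 (fun f => f k)).
have [k0 _] := infinite_setN0 Kinf.
(* Precomposition with the surjection [p] from K onto [nat * K] is injective on functions to L. *)
have [|p [_ psurj]] := card_le_ex_surj _ _ _ _ (infinite_card_natM _ Kinf).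
  by exists (0, k0).
apply: card_le_trans (strong_rank2_card_le X _ _ hX wL (@pi_character_base X)) _.
apply: (card_le_inj _ _ (fun h k => h (p k))) => h h' hh'.
apply/funext => a; have [k <-] := psurj a I.
exact: (congr1 (fun f => f k) hh').
Qed.
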